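(* For any integer $n\ge1$, any complex numbers $a_1,\ldots,a_n$ and any nonzero complex numbers $b_1,\ldots,b_n$, $$(a_1+b_1)\cdots(a_n+b_n)=\left(\prod_{i=1}^{n}b_i\right)\sum_{m=0}^{n}\ \sum_{1\le N_1<\cdots<N_m\le n}\frac{a_{N_m}\cdots a_{N_1}}{b_{N_m}\cdots b_{N_1}}=\left(\prod_{i=1}^{n}b_i\right)\sum_{m=0}^{n}(-1)^m\sum_{\substack{(y_1,\ldots,y_m)\\ \sum i y_i=m}}\prod_{i=1}^{m}\frac{(-1)^{y_i}}{y_i!}\left(\frac1i\sum_{N=1}^{n}\left(\frac{a_N}{b_N}\right)^i\right)^{y_i},$$ where, for each $m$, the sum over $(y_1,\ldots,y_m)$ runs over all partitions of $m$.
   Context: A partition of $m$ is represented by the tuple $(y_1,\ldots,y_m)$ of non-negative integers with $\sum_{i=1}^m i\,y_i=m$. For $m=0$ there is exactly one partition, the empty one. Empty products equal $1$ and $0^0=1$. The multiple sum over $1\le N_1<\cdots<N_m\le n$ equals $1$ when $m=0$. *)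

(* Defs.v *)
From mathcomp Require Import all_boot all_order all_algebra.
From mathcomp Require Import reals complex.

Set Implicit Arguments.
Unset Strict Implicit.
Unset Printing Implicit Defensive.

Import Order.TTheory GRing.Theory Num.Theory.

Local Open Scope ring_scope.

(* Indices are shifted by one throughout: i : 'I_m stands for the part size
   i.+1, and j : 'I_n stands for the index j.+1 of a and b. *)

(* Strictly increasing families N_1 < ... < N_m in {1, ..., n}. *)
Definition increasing (m n : nat) (N : {ffun 'I_m -> 'I_n}) : bool :=
  [forall i : 'I_m, forall j : 'I_m, (i < j)%N ==> (N i < N j)%N].

(* Partitions (y_1, ..., y_m) of m by multiplicities. The multiplicities are
   taken in {0, ..., m} to have finitely many candidates; by
   [partition_mult_le] this excludes no family of natural numbers. *)
Definition is_partition (m : nat) (y : {ffun 'I_m -> 'I_m.+1}) : bool :=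
  (\sum_(i < m) i.+1 * y i == m)%N.

Lemma partition_mult_le (m : nat) (y : 'I_m -> nat) :
  (\sum_(i < m) i.+1 * y i = m)%N -> forall i : 'I_m, (y i <= m)%N.
Proof.
move=> sum_y i; rewrite -[leqRHS]sum_y (bigD1 i) //=.
by apply: leq_trans (leq_addr _ _); rewrite leq_pmull.
Qed.

(* Main.v *)
Require Import Defs.
From mathcomp Require Import all_boot all_order all_algebra.
From mathcomp Require Import reals complex ring.

Set Implicit Arguments.
Unset Strict Implicit.
Unset Printing Implicit Defensive.

Import Order.TTheory GRing.Theory Num.Theory.

Local Open Scope ring_scope.

(** Put [x_j = a_j / b_j].  After division by the product of the [b_j], the
    first equality is the expansion of [\prod_j (x_j + 1)] over subsets of
    the index set, a subset of size [m] being the same thing as an increasing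
    family of length [m].

    The second equality holds for each [m] separately.  Up to the sign
    [(-1)^m], the left-hand side is the coefficient of [X^m] in
    [\prod_j (1 - x_j X)].  With [p_i = \sum_j x_j^i] and [q_i = - p_i / i],
    the inner sum over partitions is the coefficient of [X^m] in
    [\prod_i exp (q_i X^i)], and the two series are equal because
    [log (1 - x X) = - \sum_i (x X)^i / i].

    Instead of manipulating logarithms and exponentials of power series, the
    proof compares logarithmic derivatives of polynomials modulo [X^m].  The
    congruence [P' = C P] modulo [X^m] is additive in [C] when polynomials [P]
    are multiplied ([logderiv_prod]), and together with the constant term of
    [P] it determines the coefficients of [P] up to degree [m]
    ([logderiv_uniq]).  Replacing [exp (q X^i)] by its Taylor polynomial of
    degree [m] in [q X^i] leaves this congruence true, and both products
    satisfy it with [C = - \sum_i p_i X^(i-1)] ([logderiv_linear],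
    [logderiv_trunc_exp]). *)

(** * Increasing families and subsets *)

Lemma increasing_mono {m n} (N : {ffun 'I_m -> 'I_n}) :
  increasing N -> {homo N : i j / (i < j)%N}.
Proof.
by move=> /forallP incN i j; move: (incN i) => /forallP /(_ j) /implyP.
Qed.

Lemma increasing_inj {m n} (N : {ffun 'I_m -> 'I_n}) :
  increasing N -> injective N.
Proof.
move=> /increasing_mono incN i j eqN; apply: val_inj => /=.
by case: (ltngtP i j) => // /incN; rewrite eqN ltnn.
Qed.

Lemma sorted_enum_ord n (A : {pred 'I_n}) :
  sorted (relpre val ltn) (enum A).
Proof.
rewrite /(enum A); apply: sorted_filter.
  by move=> i j k /=; apply: ltn_trans.
by rewrite -sorted_map -enumT val_enum_ord iota_ltn_sorted.
Qed.

(** The list of values of an increasing family is the sorted list of the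
    elements of its image, hence is determined by the image. *)
Lemma increasing_image_inj {m n} :
  {in @increasing m n &,
    injective (fun N : {ffun 'I_m -> 'I_n} => N @: [set: 'I_m])}.
Proof.
move=> N N' incN incN' eqNN'; apply/ffunP => i.
have sortedN (L : {ffun 'I_m -> 'I_n}) :
    increasing L -> sorted (relpre val ltn) (codom L).
  move=> /increasing_mono incL.
  by apply: homo_sorted (sorted_enum_ord predT) => j k; apply: incL.
have : codom N = codom N'.
  apply: (irr_sorted_eq _ _ (sortedN _ incN) (sortedN _ incN')).
  - by move=> j k l /=; apply: ltn_trans.
  - by move=> j /=; rewrite ltnn.
  - move=> j; have /setP/(_ j) := eqNN'.
    have mem_im (L : {ffun 'I_m -> 'I_n}) :
        (j \in L @: [set: 'I_m]) = (j \in codom L).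
      by apply/imsetP/codomP => [[k _ ->]|[k ->]]; exists k.
    by rewrite !mem_im.
by move=> /eq_in_map/(_ i); apply; rewrite mem_enum.
Qed.

(** A subset is the image of the family that lists it in increasing order, and
    an increasing family has as many values as indices. *)
Lemma increasing_image m n :
  [set J : {set 'I_n} | #|J| == m] =
  [set N @: [set: 'I_m] | N : {ffun 'I_m -> 'I_n} in @increasing m n].
Proof.
apply/setP => J; rewrite inE.
apply/eqP/imsetP => [cardJ | [N incN ->]]; last first.
  by rewrite card_imset ?cardsT ?card_ord//; apply: increasing_inj.
subst m.
exists [ffun k : 'I_#|J| => enum_val k].
  apply/forallP => i; apply/forallP => j; apply/implyP => ltij.
  have x0 := enum_val i; rewrite !ffunE !(enum_val_nth x0).
  have tr : transitive (relpre (@nat_of_ord n) ltn).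
    by move=> k l p /=; apply: ltn_trans.
  by apply: (sorted_ltn_nth tr x0 (sorted_enum_ord (mem J)));
    rewrite ?inE -?cardE.
apply/setP => j; apply/idP/imsetP => [Jj | [k _ ->]]; last first.
  by rewrite ffunE enum_valP.
by exists (enum_rank_in Jj j); rewrite ?inE// ffunE enum_rankK_in.
Qed.

Lemma sum_increasing (F : comNzRingType) m n (x : 'I_n -> F) :
  \sum_(N : {ffun 'I_m -> 'I_n} | increasing N) \prod_(k < m) x (N k) =
  \sum_(J : {set 'I_n} | #|J| == m) \prod_(j in J) x j.
Proof.
transitivity (\sum_(J in [set J : {set 'I_n} | #|J| == m]) \prod_(j in J) x j).
  rewrite increasing_image big_imset; last exact: increasing_image_inj.
  apply: eq_bigr => N incN; rewrite big_imset /=.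
    by apply: eq_bigl => k; rewrite inE.
  by move=> ? ? _ _; apply: increasing_inj.
by apply: eq_bigl => J; rewrite inE.
Qed.

(** * Elementary symmetric functions as coefficients *)

Lemma prod_add1 (F : comNzRingType) n (x : 'I_n -> F) :
  \prod_(j < n) (x j + 1) = \sum_(J : {set 'I_n}) \prod_(j in J) x j.
Proof.
by rewrite bigA_distr; apply: eq_bigr => J _; rewrite [RHS]big_mkcond.
Qed.

Lemma prod_add1_increasing (F : comNzRingType) n (x : 'I_n -> F) :
  \prod_(j < n) (x j + 1) =
  \sum_(m < n.+1)
    \sum_(N : {ffun 'I_m -> 'I_n} | increasing N) \prod_(k < m) x (N k).
Proof.
have cardJ (J : {set 'I_n}) : (#|J| < n.+1)%N.
  by rewrite ltnS -[leqRHS]card_ord max_card.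
rewrite prod_add1 (partition_big (fun J => Ordinal (cardJ J)) xpredT) //=.
by apply: eq_bigr => m _; rewrite sum_increasing.
Qed.

Lemma coef_prod_linear (F : comNzRingType) n (x : 'I_n -> F) m :
  (\prod_(j < n) (x j *: 'X + 1))`_m =
  \sum_(N : {ffun 'I_m -> 'I_n} | increasing N) \prod_(k < m) x (N k).
Proof.
rewrite prod_add1 coef_sum sum_increasing [RHS]big_mkcond.
apply: eq_bigr => J _; rewrite scaler_prod prodr_const coefZ coefXn eq_sym.
by case: eqP; rewrite (mulr1, mulr0).
Qed.

(** * Polynomials with a prescribed logarithmic derivative *)

Section LogarithmicDerivative.
Variables (F : numFieldType) (M : nat).
Implicit Types P Q C D : {poly F}.

(** A form of [P' / P = C] modulo [X^M] that involves no inverse series. *)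
Definition logderiv P C := 'X^M %| P^`() - C * P.

(** The logarithmic derivative of a product is the sum of those of its
    factors. *)
Lemma logderivM P Q C D :
  logderiv P C -> logderiv Q D -> logderiv (P * Q) (C + D).
Proof.
rewrite /logderiv derivM => PC QD.
have -> : P^`() * Q + P * Q^`() - (C + D) * (P * Q)
        = (P^`() - C * P) * Q + P * (Q^`() - D * Q) by ring.
by apply: dvdp_add; [apply: dvdp_mulr | apply: dvdp_mull].
Qed.

Lemma logderiv_prod (I : finType) (P C : I -> {poly F}) :
  (forall i, logderiv (P i) (C i)) -> logderiv (\prod_i P i) (\sum_i C i).
Proof.
move=> PC; apply: (big_ind2 logderiv) => //.
  by rewrite /logderiv derivC mul0r subr0 dvdp0.
by move=> P1 C1 P2 C2; apply: logderivM.
Qed.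

(** For [P = \prod_j (1 - x_j X)] and the [C] of [logderiv_linear] summed over
    [j], this recursion is Newton's identities. *)
Lemma logderiv_coef P C k : logderiv P C -> (k < M)%N ->
  P`_k.+1 *+ k.+1 = \sum_(i < k.+1) C`_i * P`_(k - i).
Proof.
move=> /dvdpP[Q eqQ] ltkM; rewrite -coefM -coef_deriv; apply/eqP.
by rewrite -subr_eq0 -coefB eqQ coefMXn ltkM.
Qed.

(** In characteristic zero the recursion of [logderiv_coef] can be solved for
    its highest coefficient. *)
Lemma logderiv_uniq P Q C : logderiv P C -> logderiv Q C -> P`_0 = Q`_0 ->
  forall k, (k <= M)%N -> P`_k = Q`_k.
Proof.
move=> PC QC eq0; elim/ltn_ind => -[//|k] IH ltkM.
apply: (pmulrnI (ltn0Sn k)) => /=.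
rewrite (logderiv_coef PC)// (logderiv_coef QC)//.
apply: eq_bigr => i _; congr (_ * _); apply: IH.
  by rewrite ltnS leq_subr.
exact: leq_trans (leq_subr _ _) (ltnW ltkM).
Qed.

(** [(1 - x X)' / (1 - x X) = - x / (1 - x X)], a geometric series. *)
Lemma logderiv_linear x :
  logderiv (- x *: 'X + 1) (- \sum_(i < M) x ^+ i.+1 *: 'X^i).
Proof.
rewrite /logderiv.
have -> : \sum_(i < M) x ^+ i.+1 *: 'X^i = x%:P * \sum_(i < M) (x *: 'X) ^+ i.
  rewrite big_distrr; apply: eq_bigr => i _ /=.
  by rewrite exprZn mul_polyC scalerA -exprS.
have := subrX1 (x *: 'X) M; set S := \sum_(i < M) _ => geom.
rewrite derivD derivZ derivX derivC.
have -> : - x *: 1 + 0 - - (x%:P * S) * (- x *: 'X + 1)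
   = - x%:P * ((x *: 'X - 1) * S + 1) :> {poly F}.
  by rewrite -!mul_polyC polyCN; ring.
by rewrite -geom subrK exprZn -mul_polyC !dvdp_mull.
Qed.

(** Part sizes are shifted by one: this is [exp (q X^(i+1))], cut after the
    power [M] of its argument. *)
Definition trunc_exp (q : F) (i : nat) : {poly F} :=
  \sum_(k < M.+1) (q ^+ k / k`!%:R) *: 'X^(i.+1 * k).

Lemma logderiv_trunc_exp q i : logderiv (trunc_exp q i) ((q *+ i.+1) *: 'X^i).
Proof.
have facU k : k`!%:R != 0 :> F by rewrite pnatr_eq0 -lt0n fact_gt0.
rewrite /logderiv /trunc_exp raddf_sum big_ord_recl big_ord_recr /=.
rewrite mulrDr big_distrr /=.
rewrite muln0 derivZ derivXn mulr0n scaler0 add0r opprD addrA.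
(* Both copies of the sum lose one end: the constant term of the truncated
   exponential is killed by derivation, and its top term, once multiplied by
   'X^i, has degree at least M.  What remains agrees after an index shift. *)
rewrite (_ : \sum_(k < M) _ =
  \sum_(k < M)
    (q *+ i.+1 *: 'X^i * ((q ^+ k / k`!%:R) *: 'X^(i.+1 * k)))).
  rewrite subrr add0r dvdpNr dvdp_mull// -mul_polyC dvdp_mull//.
  by rewrite mulSn exprD dvdp_mulr.
apply: eq_bigr => k _; rewrite /bump /= add1n derivZ derivXn.
rewrite -scalerAl -scalerAr scalerA -exprD -scaler_nat scalerA.
have -> : (i.+1 * k.+1).-1 = (i + i.+1 * k)%N by rewrite mulnS.
congr (_ *: _); rewrite factS !natrM exprS -mulr_natr.
have k1U : k.+1%:R != 0 :> F by rewrite pnatr_eq0.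
by field; rewrite facU addrC natr1 k1U.
Qed.

Lemma coef0_prod (I : finType) (P : I -> {poly F}) :
  (forall i, (P i)`_0 = 1) -> (\prod_i P i)`_0 = 1.
Proof.
move=> P0; rewrite -horner_coef0 horner_prod big1// => i _.
by rewrite horner_coef0 P0.
Qed.

(** Choosing the term of index [y i] in the [i]-th factor contributes to the
    power of [X] given by the weight of [y]; multiplicities above [M] could
    not occur in a term of degree [M], so the truncation loses nothing. *)
Lemma coef_prod_trunc_exp m (q : nat -> F) :
  (\prod_(i < m) trunc_exp (q i) i)`_M =
  \sum_(y : {ffun 'I_m -> 'I_M.+1} | (\sum_(i < m) i.+1 * y i == M)%N)
     \prod_(i < m) (q i ^+ y i / (y i)`!%:R).
Proof.
rewrite bigA_distr_bigA coef_sum [RHS]big_mkcond; apply: eq_bigr => y _ /=.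
rewrite scaler_prod -(big_morph _ (exprD 'X) (expr0 _)) coefZ coefXn eq_sym.
by case: eqP; rewrite (mulr1, mulr0).
Qed.

End LogarithmicDerivative.

(** * Elementary symmetric functions as sums over partitions *)

(** The signs [(-1)^(y_i)] are absorbed in [q_i = - p_i / i], so that the sum
    over partitions becomes that of [coef_prod_trunc_exp].  Truncating at the
    degree [m] of the coefficient under study makes the multiplicities range
    over exactly the values allowed in a partition of [m]. *)
Lemma elementary_partition (F : numFieldType) m n (x : 'I_n -> F) :
  \sum_(N : {ffun 'I_m -> 'I_n} | increasing N) \prod_(k < m) x (N k) =
  (-1) ^+ m *
   \sum_(y : {ffun 'I_m -> 'I_m.+1} | is_partition y)
     \prod_(i < m)
       ((-1) ^+ y i / (y i)`!%:R *
        (i.+1%:R^-1 * \sum_(j < n) x j ^+ i.+1) ^+ y i).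
Proof.
pose q i : F := - (i.+1%:R^-1 * \sum_(j < n) x j ^+ i.+1).
have := coef_prod_trunc_exp m m q; rewrite /is_partition.
under [in RHS]eq_bigr => y _ do under eq_bigr => i _ do
  rewrite /q [in X in X / _]exprNn mulrAC.
move<-.
have lhs : logderiv m (\prod_(j < n) (- x j *: 'X + 1))
   (\sum_(i < m) (q i *+ i.+1) *: 'X^i).
  have -> : \sum_(i < m) (q i *+ i.+1) *: 'X^i
     = \sum_(j < n) - \sum_(i < m) x j ^+ i.+1 *: 'X^i :> {poly F}.
    rewrite sumrN exchange_big -sumrN; apply: eq_bigr => i _.
    rewrite -scaler_suml -scaleNr /q mulNrn -mulrnAl -[_ *+ _]mulr_natr.
    rewrite mulVf ?mul1r//.
    by rewrite pnatr_eq0.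
  by apply: logderiv_prod => j; apply: logderiv_linear.
have rhs : logderiv m (\prod_(i < m) trunc_exp m (q i) i)
   (\sum_(i < m) (q i *+ i.+1) *: 'X^i).
  by apply: logderiv_prod => i; apply: logderiv_trunc_exp.
rewrite -(logderiv_uniq lhs rhs) ?leqnn//; last first.
  rewrite !coef0_prod// => [i|j]; last first.
    by rewrite coefD coefZ coefX coefC mulr0 add0r.
  rewrite /trunc_exp coef_sum big_ord_recl big1 ?addr0.
    by rewrite muln0 coefZ coefXn expr0 fact0 invr1 !mulr1.
  by move=> k _; rewrite coefZ coefXn /= mulr0.
rewrite coef_prod_linear big_distrr; apply: eq_bigr => N _ /=.
rewrite prodrN card_ord mulrA -exprD addnn -mul2n exprM sqrrN expr1n.
by rewrite expr1n mul1r.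
Qed.

Theorem theorem4p4 (R : realType) (n : nat) (hn : (1 <= n)%N)
    (a b : 'I_n -> R[i]) (hb : forall j : 'I_n, b j != 0) :
  (\prod_(j < n) (a j + b j)
   = (\prod_(j < n) b j) *
     \sum_(m < n.+1) \sum_(N : {ffun 'I_m -> 'I_n} | increasing N)
       (\prod_(k < m) a (N k)) / (\prod_(k < m) b (N k)))
  /\
  ((\prod_(j < n) b j) *
     \sum_(m < n.+1) \sum_(N : {ffun 'I_m -> 'I_n} | increasing N)
       (\prod_(k < m) a (N k)) / (\prod_(k < m) b (N k))
   = (\prod_(j < n) b j) *
     \sum_(m < n.+1) (-1) ^+ m *
       \sum_(y : {ffun 'I_m -> 'I_m.+1} | is_partition y)
         \prod_(i < m)
           ((-1) ^+ y i / (y i)`!%:R *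
            ((i.+1)%:R^-1 * \sum_(j < n) (a j / b j) ^+ i.+1) ^+ y i)).
Proof.
have esym_ratio m :
    \sum_(N : {ffun 'I_m -> 'I_n} | increasing N)
      (\prod_(k < m) a (N k)) / (\prod_(k < m) b (N k)) =
    \sum_(N : {ffun 'I_m -> 'I_n} | increasing N)
      \prod_(k < m) (a (N k) / b (N k)).
  by apply: eq_bigr => N _; rewrite prodf_div.
under [\sum_(m < n.+1) \sum_(N | increasing N) _]eq_bigr => m _ do
  rewrite esym_ratio.
split.
  rewrite -(prod_add1_increasing (fun j => a j / b j)) -big_split /=.
  by apply: eq_bigr => j _; rewrite mulrDr mulr1 mulrC divfK.
congr (_ * _); apply: eq_bigr => m _.
exact: (elementary_partition m (fun j => a j / b j)).
Qed.
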